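(* Let $n\geq 3$, let $t$ be an indeterminate, let $f(t)\in\mathbb{Z}[t^{\pm1}]$ be invertible, and let $\eta_2:T_n\rightarrow\mathrm{GL}_n(\mathbb{Z}[t^{\pm1}])$ be the representation of the twin group given by $\eta_2(s_i)=\left(\begin{array}{c|c|c} I_{i-1} & 0 & 0\\ \hline 0 & \begin{matrix}0 & f(t)\\ f(t)^{-1} & 0\end{matrix} & 0\\ \hline 0&0&I_{n-i-1}\end{array}\right)$ for $1\leq i\leq n-1$. Let $\hat{\eta}_2:VT_n\rightarrow\mathrm{GL}_n(\mathbb{Z}[t^{\pm1}])$ be a $2$-local representation of the virtual twin group $VT_n$ that extends $\eta_2$ (i.e. $\hat\eta_2(s_i)=\eta_2(s_i)$ for all $i$). Then there is an invertible element $g(t)\in\mathbb{Z}[t^{\pm1}]$ such that, for all $1\leq i\leq n-1$, $$\hat{\eta}_2(s_i)=\left(\begin{array}{c|c|c} I_{i-1} & 0 & 0\\ \hline 0 & \begin{matrix}0 & f(t)\\ f(t)^{-1} & 0\end{matrix} & 0\\ \hline 0&0&I_{n-i-1}\end{array}\right),\qquad \hat{\eta}_2(\rho_i)=\left(\begin{array}{c|c|c} I_{i-1} & 0 & 0\\ \hline 0 & \begin{matrix}0 & g(t)\\ g(t)^{-1} & 0\end{matrix} & 0\\ \hline 0&0&I_{n-i-1}\end{array}\right).$$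
   Context: The twin group $T_n$ has generators $s_1,\ldots,s_{n-1}$ and relations $s_i^2=1$ ($1\le i\le n-1$), $s_is_j=s_js_i$ ($|i-j|\geq2$). The virtual twin group $VT_n$ has generators $s_1,\ldots,s_{n-1},\rho_1,\ldots,\rho_{n-1}$, with the relations of $T_n$ together with: $\rho_i\rho_{i+1}\rho_i=\rho_{i+1}\rho_i\rho_{i+1}$ ($1\le i\le n-2$); $\rho_i\rho_j=\rho_j\rho_i$ ($|i-j|\geq 2$); $\rho_i^2=1$ ($1\le i\le n-1$); $s_i\rho_j=\rho_js_i$ ($|i-j|\geq2$); $\rho_i\rho_{i+1}s_i=s_{i+1}\rho_i\rho_{i+1}$ ($1\le i\le n-2$). A representation $\theta:VT_n\to\mathrm{GL}_n(\mathbb{Z}[t^{\pm1}])$ is $2$-local if for each $1\leq i\leq n-1$ there are $M_i,N_i\in\mathrm{GL}_2(\mathbb{Z}[t^{\pm1}])$ with $\theta(s_i)=\mathrm{diag}(I_{i-1},M_i,I_{n-i-1})$ and $\theta(\rho_i)=\mathrm{diag}(I_{i-1},N_i,I_{n-i-1})$ (block diagonal). $I_r$ is the $r\times r$ identity matrix. *)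

(* Defs.v *)
From HB Require Import structures.
From mathcomp Require Import all_boot all_order all_algebra.
From mathcomp Require Import generic_quotient boolp.

Set Implicit Arguments.
Unset Strict Implicit.
Unset Printing Implicit Defensive.

Import GRing.Theory.
Local Open Scope ring_scope.
Local Open Scope quotient_scope.

Section Laurent.
Variable R : idomainType.

(* R[t, t^-1], realized as the subring of R(t) of the fractions p / t^k. *)
Definition is_laurent : pred {fraction {poly R}} := fun x =>
  `[< exists (p : {poly R}) (k : nat),
        x = tofrac p / (tofrac ('X : {poly R})) ^+ k >].

Fact tofracX_neq0 : tofrac ('X : {poly R}) != 0.
Proof. by rewrite tofrac_eq0 polyX_eq0. Qed.

Fact is_laurent_subring : subring_closed is_laurent.
Proof.
have X0 k : tofrac ('X : {poly R}) ^+ k != 0 by rewrite expf_neq0 ?tofracX_neq0.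
split.
- by apply/asboolP; exists 1, 0%N; rewrite tofrac1 expr0 divr1.
- move=> x y /asboolP[p [k ->]] /asboolP[q [l ->]]; apply/asboolP.
  exists (p * 'X^l - q * 'X^k), (k + l)%N.
  rewrite tofracB !tofracM !tofracXn exprD -mulNr addf_div //.
  by rewrite mulNr.
- move=> x y /asboolP[p [k ->]] /asboolP[q [l ->]]; apply/asboolP.
  exists (p * q), (k + l)%N.
  by rewrite tofracM exprD mulf_div.
Qed.

HB.instance Definition _ :=
  GRing.isSubringClosed.Build {fraction {poly R}} is_laurent is_laurent_subring.

Record laurent := Laurent {
  laurent_val : {fraction {poly R}};
  _ : laurent_val \in is_laurent }.

HB.instance Definition _ := [isSub for laurent_val].
HB.instance Definition _ := [Choice of laurent by <:].
HB.instance Definition _ := [SubChoice_isSubComNzRing of laurent by <:].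

(* Invertibility is taken in [laurent], not in the ambient field. *)
Definition laurent_unit : pred laurent := fun x =>
  (x != 0) && ((laurent_val x)^-1 \in is_laurent).
Definition laurent_inv (x : laurent) : laurent :=
  if laurent_unit x then insubd x (laurent_val x)^-1 else x.

Fact laurent_valM (x y : laurent) :
  laurent_val (x * y) = laurent_val x * laurent_val y.
Proof. exact: (rmorphM (val : laurent -> {fraction {poly R}})). Qed.
Fact laurent_val1 : laurent_val 1 = 1.
Proof. exact: (rmorph1 (val : laurent -> {fraction {poly R}})). Qed.
Fact laurent_val0 : laurent_val 0 = 0.
Proof. exact: (raddf0 (val : laurent -> {fraction {poly R}})). Qed.

Fact laurent_val_neq0 (x : laurent) : (laurent_val x != 0) = (x != 0).
Proof. by rewrite -laurent_val0 (inj_eq (@val_inj _ _ laurent)). Qed.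

Fact laurent_mulVr : {in laurent_unit, left_inverse 1 laurent_inv *%R}.
Proof.
move=> x ux; have {}ux : laurent_unit x := ux; rewrite /laurent_inv ux.
case/andP: ux => x0 lx; apply: val_inj.
rewrite [LHS]laurent_valM [RHS]laurent_val1.
have -> : laurent_val (insubd x (laurent_val x)^-1) = (laurent_val x)^-1 := insubdK x lx.
by apply: mulVf; rewrite laurent_val_neq0.
Qed.

Fact laurent_unitP (x y : laurent) : y * x = 1 -> laurent_unit x.
Proof.
move=> yx1; have e : laurent_val y * laurent_val x = 1.
  by rewrite -laurent_valM yx1 laurent_val1.
have x0 : laurent_val x != 0.
  by apply/eqP => x0; move/eqP: e; rewrite x0 mulr0 eq_sym oner_eq0.
apply/andP; split; first by rewrite -laurent_val_neq0.
have -> : (laurent_val x)^-1 = laurent_val y by rewrite -[LHS]mul1r -e mulfK.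
exact: (valP y).
Qed.

Fact laurent_inv_out : {in [predC laurent_unit], laurent_inv =1 id}.
Proof.
move=> x ux; have {}ux : laurent_unit x = false := negbTE ux.
by rewrite /laurent_inv ux.
Qed.

HB.instance Definition _ := GRing.ComNzRing_hasMulInverse.Build laurent
  laurent_mulVr laurent_unitP laurent_inv_out.
HB.instance Definition _ := [SubComUnitRing_isSubIntegralDomain of laurent by <:].

End Laurent.

Section GeneralLinear.
Variables (R : comUnitRingType) (n : nat).

Record GL := MkGL { GL_mx :> 'M[R]_n; _ : GL_mx \in unitmx }.

HB.instance Definition _ := [isSub for GL_mx].
HB.instance Definition _ := [Choice of GL by <:].

Fact GL_mul_proof (A B : GL) : GL_mx A *m GL_mx B \in unitmx.
Proof. by rewrite unitmx_mul (valP A) (valP B). Qed.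
Fact GL_inv_proof (A : GL) : invmx (GL_mx A) \in unitmx.
Proof. by rewrite unitmx_inv (valP A). Qed.

Definition GL_mul A B := MkGL (GL_mul_proof A B).
Definition GL_inv A := MkGL (GL_inv_proof A).
Definition GL_one := MkGL (unitmx1 R n).

Fact GL_mulA : associative GL_mul.
Proof. by move=> A B C; apply/val_inj/mulmxA. Qed.
Fact GL_mul1 : left_id GL_one GL_mul.
Proof. by move=> A; apply/val_inj/mul1mx. Qed.
Fact GL_mulr1 : right_id GL_one GL_mul.
Proof. by move=> A; apply/val_inj/mulmx1. Qed.
Fact GL_mulV : left_inverse GL_one GL_inv GL_mul.
Proof. by move=> A; apply/val_inj/mulVmx/(valP A). Qed.
Fact GL_mulrV : right_inverse GL_one GL_inv GL_mul.
Proof. by move=> A; apply/val_inj/mulmxV/(valP A). Qed.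

HB.instance Definition _ :=
  isGroup.Build GL GL_mulA GL_mul1 GL_mulr1 GL_mulV GL_mulrV.

End GeneralLinear.

(* A letter (x, false) is the generator x, and (x, true) is its inverse. *)
Definition word (X : Type) := seq (X * bool).

Definition word_inv (X : Type) (w : word X) : word X :=
  rev [seq (a.1, ~~ a.2) | a <- w].

Section Presentation.
Variables (X : choiceType) (rels : word X -> word X -> Prop).

Inductive pres_eq : word X -> word X -> Prop :=
| pres_refl u : pres_eq u u
| pres_sym u v : pres_eq u v -> pres_eq v u
| pres_trans u v w : pres_eq u v -> pres_eq v w -> pres_eq u w
| pres_cat u v u' v' :
    pres_eq u v -> pres_eq u' v' -> pres_eq (u ++ u') (v ++ v')
| pres_cancel x b : pres_eq [:: (x, b); (x, ~~ b)] [::]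
| pres_rel u v : rels u v -> pres_eq u v.

Definition pres_eqb (u v : word X) : bool := `[< pres_eq u v >].

Fact pres_eqb_equiv : equiv_class_of pres_eqb.
Proof.
split=> [u|u v|v u w].
- exact/asboolP/pres_refl.
- by apply/asboolP/asboolP; apply: pres_sym.
- by move=> /asboolP uv /asboolP vw; apply/asboolP/(pres_trans uv vw).
Qed.

Canonical pres_equiv := EquivRelPack pres_eqb_equiv.

Definition presented := {eq_quot pres_eqb}.
HB.instance Definition _ := Choice.on presented.
HB.instance Definition _ := Quotient.on presented.

Implicit Types g h k : presented.

Definition pres_mul g h : presented := \pi_presented (repr g ++ repr h).
Definition pres_inv g : presented := \pi_presented (word_inv (repr g)).
Definition pres_one : presented := \pi_presented [::].

Definition pres_gen (x : X) : presented := \pi_presented [:: (x, false)].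

Fact pres_piP (u v : word X) :
  \pi_presented u = \pi_presented v <-> pres_eq u v.
Proof.
by split=> [/eqquotP/asboolP | e] //; apply/eqquotP/asboolP.
Qed.

Fact pres_reprP (u : word X) : pres_eq (repr (\pi_presented u)) u.
Proof. by apply/pres_piP; rewrite reprK. Qed.

Fact pres_mulE (u v : word X) :
  pres_mul (\pi_presented u) (\pi_presented v) = \pi_presented (u ++ v).
Proof. by apply/pres_piP/pres_cat; apply: pres_reprP. Qed.

Fact pres_catV (u : word X) : pres_eq (u ++ word_inv u) [::].
Proof.
elim: u => [|[x b] u IH]; first exact: pres_refl.
have -> : ((x, b) :: u) ++ word_inv ((x, b) :: u)
    = [:: (x, b)] ++ ((u ++ word_inv u) ++ [:: (x, ~~ b)]).
  by rewrite /word_inv /= rev_cons -cats1 catA.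
apply: (pres_trans (v := [:: (x, b)] ++ ([::] ++ [:: (x, ~~ b)]))).
  apply: pres_cat; first exact: pres_refl.
  by apply: pres_cat; [exact: IH | exact: pres_refl].
exact: pres_cancel.
Qed.

Fact word_invK : involutive (@word_inv X).
Proof.
move=> w; rewrite /word_inv map_rev revK -map_comp -[RHS]map_id.
by apply: eq_map => -[x b] /=; rewrite negbK.
Qed.

Fact pres_mulA : associative pres_mul.
Proof.
elim/quotW=> u; elim/quotW=> v; elim/quotW=> w.
by rewrite (pres_mulE v w) (pres_mulE u v) (pres_mulE u) (pres_mulE _ w) catA.
Qed.
Fact pres_mul1 : left_id pres_one pres_mul.
Proof. by elim/quotW=> u; apply: pres_mulE. Qed.
Fact pres_mulr1 : right_id pres_one pres_mul.
Proof. by elim/quotW=> u; rewrite pres_mulE cats0. Qed.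
Fact pres_mulrV : right_inverse pres_one pres_inv pres_mul.
Proof.
move=> g; rewrite -[X in pres_mul X _]reprK pres_mulE.
exact/pres_piP/pres_catV.
Qed.
Fact pres_mulV : left_inverse pres_one pres_inv pres_mul.
Proof.
move=> g; rewrite -[X in pres_mul _ X]reprK pres_mulE; apply/pres_piP.
by rewrite -[X in _ ++ X]word_invK; apply: pres_catV.
Qed.

HB.instance Definition _ :=
  isGroup.Build presented pres_mulA pres_mul1 pres_mulr1 pres_mulV pres_mulrV.

End Presentation.

(* The generators are numbered from 0: i : 'I_n.-1 stands for s_(i+1), and
   likewise for rho. *)
Section Twin.
Variable n : nat.
Implicit Types i j : 'I_n.-1.

Definition far i j : bool := (i.+2 <= j)%N || (j.+2 <= i)%N.

Let a i : 'I_n.-1 * bool := (i, false).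

Inductive twin_rels : word 'I_n.-1 -> word 'I_n.-1 -> Prop :=
| twin_sq i : twin_rels [:: a i; a i] [::]
| twin_comm i j : far i j -> twin_rels [:: a i; a j] [:: a j; a i].

Definition twin := presented twin_rels.
HB.instance Definition _ := Group.on twin.

Definition twin_s i : twin := pres_gen twin_rels i.

Let s i : ('I_n.-1 + 'I_n.-1) * bool := (inl i, false).
Let r i : ('I_n.-1 + 'I_n.-1) * bool := (inr i, false).

Inductive vtwin_rels :
  word ('I_n.-1 + 'I_n.-1)%type -> word ('I_n.-1 + 'I_n.-1)%type -> Prop :=
| vtwin_sq i : vtwin_rels [:: s i; s i] [::]
| vtwin_comm i j : far i j -> vtwin_rels [:: s i; s j] [:: s j; s i]
| vtwin_rho_braid i j : j = i.+1 :> nat ->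
    vtwin_rels [:: r i; r j; r i] [:: r j; r i; r j]
| vtwin_rho_comm i j : far i j -> vtwin_rels [:: r i; r j] [:: r j; r i]
| vtwin_rho_sq i : vtwin_rels [:: r i; r i] [::]
| vtwin_mixed_comm i j : far i j -> vtwin_rels [:: s i; r j] [:: r j; s i]
| vtwin_mixed i j : j = i.+1 :> nat ->
    vtwin_rels [:: r i; r j; s i] [:: s j; r i; r j].

Definition vtwin := presented vtwin_rels.
HB.instance Definition _ := Group.on vtwin.

Definition vtwin_s i : vtwin := pres_gen vtwin_rels (inl i).
Definition vtwin_rho i : vtwin := pres_gen vtwin_rels (inr i).

End Twin.

Section Local.
Variables (R : comUnitRingType) (n : nat).
Implicit Types i : 'I_n.-1.

Fact local_dim i : (i + (2 + (n - i.+2)) = n)%N.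
Proof. by rewrite addnA addn2 subnKC //; case: n i => [[]|n'] // i; apply: ltn_ord. Qed.

(* diag(I_i, M, I_(n-i-2)), with i counted from 0. *)
Definition local_mx i (M : 'M[R]_2) : 'M[R]_n :=
  castmx (local_dim i, local_dim i)
    (block_mx (1%:M : 'M_i) 0 0 (block_mx M 0 0 1%:M)).

(* The matrix with rows (0, a) and (a^-1, 0). *)
Definition antidiag_mx (a : R) : 'M[R]_2 :=
  block_mx (0 : 'M_1) a%:M (a^-1)%:M (0 : 'M_1).

Definition two_local (theta : vtwin n -> GL R n) : Prop :=
  forall i, exists M N : GL R 2,
    theta (vtwin_s i) = local_mx i M :> 'M[R]_n /\
    theta (vtwin_rho i) = local_mx i N :> 'M[R]_n.

End Local.

Notation "{ 'group_hom' G -> H }" := (UMagmaMorphism.type G H)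
  (at level 0, G at level 98, H at level 99,
   format "{ 'group_hom'  G  ->  H }") : type_scope.

(* Main.v *)
Require Import Defs.
From mathcomp Require Import all_boot all_order all_algebra.
From mathcomp Require Import generic_quotient.

Set Implicit Arguments.
Unset Strict Implicit.
Unset Printing Implicit Defensive.

Import GRing.Theory.
Local Open Scope ring_scope.
Local Open Scope quotient_scope.

(** Everything happens in the 3 x 3 corner touched by two neighbours i and
    j = i + 1. Let N = (a, b; c, d) and P = (p, q; r, s) be the blocks of rho_i
    and rho_j. Comparing the rows i and i + 1 of the two sides of the mixed
    relation rho_i rho_j s_i = s_j rho_i rho_j gives
      a = b p / f,   d p = 0,   c = r,   d q = f s,
    while rho^2 = 1 makes N and P involutions, so a^2 + b c = b c + d^2 =
    p^2 + q r = 1. The ring Z[t, 1/t] is a domain, so d p = 0 forces d = 0 or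
    p = 0, and each case kills all four diagonal entries: if d = 0 then
    b c = 1, hence a^2 = 0; if p = 0 then a = 0, hence b c = 1 and d^2 = 0. What
    is left is b c = q r = 1 with c = r, so both blocks are the antidiagonal
    matrix of the same unit b ([mixed_involutions_antidiag]). As n >= 3, every
    index has a neighbour, and the unit b propagates along the chain of indices.

    The entries are compared by letting the matrices act on the right of the
    basis row vectors e_x: a local matrix moves only two of them
    ([local_mx_row], [local_mx_row_out]), so a product of local matrices is
    computed without any sum over all the indices. *)

(** * Entries of the blocks of two neighbouring involutions *)

(** The hypotheses are the entries of N^2 = 1, P^2 = 1 and of the mixed relation
    for N = (a, b; c, d) and P = (p, q; r, s); the domain assumption enters
    through d p = 0 and through square roots of 0. *)
Lemma mixed_involutions_antidiag (R : idomainType) (f a b c d p q r s : R) :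
  f \is a GRing.unit ->
  a * a + b * c = 1 -> c * b + d * d = 1 -> p * p + q * r = 1 ->
  a = b * p * f^-1 -> 0 = d * p * f^-1 -> r * f = c * f -> s * f = d * q ->
  [/\ a = 0, d = 0 & b * c = 1] /\ [/\ p = 0, s = 0, q = b & r = c].
Proof.
move=> fU ha hd hp e1 e2 e3 e4.
have f0 : f != 0 by apply: contraTneq fU => ->; rewrite unitr0.
have rc : r = c by apply: (mulIf f0).
have dp0 : d * p == 0 by rewrite -(mulrVK fU (d * p)) -e2 mul0r.
have [a0 d0] : a = 0 /\ d = 0.
  have sq0 (x y : R) : x * x + y = 1 -> y = 1 -> x = 0.
    move=> h y1; apply/eqP; rewrite -[_ == 0]sqrf_eq0 expr2.
    by move: h; rewrite y1 => /(canRL (addrK 1)) ->; rewrite subrr.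
  move: dp0; rewrite mulf_eq0 => /orP[] /eqP z0.
    split=> //; apply: (sq0 _ _ ha).
    by move: hd; rewrite z0 mulr0 addr0 mulrC.
  have a0 : a = 0 by rewrite e1 z0 mulr0 mul0r.
  split=> //; rewrite addrC in hd; apply: (sq0 _ _ hd).
  by move: ha; rewrite a0 mulr0 add0r mulrC.
have bc1 : b * c = 1 by move: ha; rewrite a0 mulr0 add0r.
have b0 : b != 0.
  by apply/eqP => b0; move/eqP: bc1; rewrite b0 mul0r eq_sym oner_eq0.
have p0 : p = 0.
  apply: (mulfI b0); rewrite mulr0 -[LHS](mulrVK fU) -e1.
  by rewrite a0 mul0r.
have s0 : s = 0 by apply: (mulIf f0); rewrite mul0r e4 d0 mul0r.
split; split=> //.
have c0 : c != 0.
  by apply/eqP => c0; move/eqP: bc1; rewrite c0 mulr0 eq_sym oner_eq0.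
by apply: (mulIf c0); rewrite bc1 -hp p0 mul0r add0r rc.
Qed.

(** * Local matrices acting on row vectors *)

Section LocalRows.
Variables (R : comUnitRingType) (n : nat).
Implicit Types (i : 'I_n.-1) (M N : 'M[R]_2) (x y u v : 'I_n).

Lemma local_mxE i M x y :
  local_mx i M x y =
    if ((i <= x < i.+2) && (i <= y < i.+2))%N
    then M (inord (x - i)) (inord (y - i)) else (x == y)%:R.
Proof.
have lt_block k : (i + k < i.+2)%N = (k < 2)%N by rewrite -addn2 ltn_add2l.
rewrite /local_mx castmxE /= !mxE -val_eqE /=.
case: splitP => x1 /= ex; rewrite !mxE; case: splitP => y1 /= ey;
  rewrite !mxE ex ey.
- by rewrite leqNgt ltn_ord /=.
- by rewrite leqNgt ltn_ord /= ltn_eqF // (leq_trans (ltn_ord x1)) ?leq_addr.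
- rewrite (leqNgt i y1) ltn_ord andbF.
  by rewrite gtn_eqF // (leq_trans (ltn_ord y1)) ?leq_addr.
case: splitP => x2 /= ex2; rewrite mxE; case: splitP => y2 /= ey2;
  rewrite ?mxE ex2 ey2 !leq_addr /= !lt_block ?ltn_ord /=.
- by rewrite !addKn !inord_val.
- by rewrite eqn_add2l ltn_eqF // (leq_trans (ltn_ord x2)) ?leq_addr.
- by rewrite eqn_add2l gtn_eqF // (leq_trans (ltn_ord y2)) ?leq_addr.
by rewrite !eqn_add2l.
Qed.

Local Notation e := (delta_mx (0 : 'I_1)).

(** Indexing the two rows of the block by k treats e_i and e_(i + 1) at once. *)
Lemma local_mx_row i M (k : 'I_2) u v (w : 'I_n) :
  u = i :> nat -> v = i.+1 :> nat -> w = (i + k)%N :> nat ->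
  e w *m local_mx i M = M k 0 *: e u + M k 1 *: e v.
Proof.
move=> eu ev ew; apply/rowP=> y.
rewrite -rowE !mxE local_mxE -!val_eqE /= eu ev ew.
have ik : (i + k < i.+2)%N
  by rewrite -[X in (_ < X)%N](addn2 i) ltn_add2l ltn_ord.
rewrite leq_addr ik addKn inord_val /=.
have [->|yi] := eqVneq (val y) i.
  rewrite leqnn ltnS leqnSn subnn /=.
  have -> : inord 0 = 0 :> 'I_2 by apply: val_inj; rewrite /= inordK.
  by rewrite ltn_eqF // mulr1 mulr0 addr0.
have [->|yi1] := eqVneq (val y) i.+1.
  rewrite leqnSn ltnSn subSnn /=.
  have -> : inord 1 = 1 :> 'I_2 by apply: val_inj; rewrite /= inordK.
  by rewrite mulr1 mulr0 add0r.
have -> : (i <= y < i.+2)%N = false.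
  by rewrite ltnS (leq_eqVlt y) (negPf yi1) ltnS -eqn_leq eq_sym (negPf yi).
rewrite !mulr0 addr0; case: eqP => // iky.
case: k {ew ik} iky => [[|[|//]]] /= _ /eqP.
  by rewrite addn0 eq_sym (negPf yi).
by rewrite addn1 eq_sym (negPf yi1).
Qed.

Lemma local_mx_row_out i M x : x != i :> nat -> x != i.+1 :> nat ->
  e x *m local_mx i M = e x.
Proof.
move=> xi xi1; apply/rowP=> y; rewrite -rowE !mxE local_mxE eq_sym.
have -> // : (i <= x < i.+2)%N = false.
by rewrite ltnS (leq_eqVlt x) (negPf xi1) ltnS -eqn_leq eq_sym (negPf xi).
Qed.

Lemma antidiag_mxE (a : R) (k l : 'I_2) :
  antidiag_mx a k l = if k == l then 0 else if k == 0 then a else a^-1.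
Proof.
rewrite /antidiag_mx !mxE -!val_eqE /=; case: splitP => k1 ->; rewrite mxE;
  by case: splitP => l1 ->; rewrite !ord1 mxE.
Qed.

Lemma local_mx_involution i N : local_mx i N *m local_mx i N = 1%:M ->
  N 0 0 * N 0 0 + N 0 1 * N 1 0 = 1 /\ N 1 0 * N 0 1 + N 1 1 * N 1 1 = 1.
Proof.
have in1 : (i.+1 < n)%N by case: n i => [[]|m i] //; rewrite ltnS.
pose u := Ordinal (ltnW in1); pose v := Ordinal in1 => NN.
have r0 N' : e u *m local_mx i N' = N' 0 0 *: e u + N' 0 1 *: e v.
  by apply: local_mx_row; rewrite // addn0.
have r1 N' : e v *m local_mx i N' = N' 1 0 *: e u + N' 1 1 *: e v.
  by apply: local_mx_row; rewrite // addn1.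
have uv : (u == v) = false by rewrite -val_eqE /= ltn_eqF.
split.
  have := congr1 (fun A => (e u *m A) 0 u) NN.
  rewrite mulmxA r0 mulmxDl -!scalemxAl r0 r1 mulmx1 !mxE !eqxx uv /=.
  by rewrite !mulr0 !mulr1 !addr0.
have := congr1 (fun A => (e v *m A) 0 v) NN.
rewrite mulmxA r1 mulmxDl -!scalemxAl r0 r1 mulmx1 !mxE !eqxx eq_sym uv /=.
by rewrite !mulr0 !mulr1 !add0r.
Qed.

(** The four equations are the entries (i, i), (i + 1, i), (i + 1, i + 1) and
    (i + 1, i + 2) of the two sides. *)
Lemma local_mx_mixed i (j : 'I_n.-1) (f : R) N (P : 'M[R]_2) :
  j = i.+1 :> nat ->
  local_mx i N *m local_mx j P *m local_mx i (antidiag_mx f) =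
    local_mx j (antidiag_mx f) *m local_mx i N *m local_mx j P ->
  [/\ N 0 0 = N 0 1 * P 0 0 * f^-1, 0 = N 1 1 * P 0 0 * f^-1,
      N 1 0 * f = P 1 0 * f & N 1 1 * P 0 1 = P 1 1 * f].
Proof.
move=> ej.
have in2 : (i.+2 < n)%N
  by rewrite -ej; case: n i j ej => [[]|m i j ej] //; rewrite ltnS.
pose u := Ordinal (ltnW (ltnW in2)); pose v := Ordinal (ltnW in2).
pose w := Ordinal in2.
have r0 N' : e u *m local_mx i N' = N' 0 0 *: e u + N' 0 1 *: e v.
  by apply: local_mx_row; rewrite // addn0.
have r1 N' : e v *m local_mx i N' = N' 1 0 *: e u + N' 1 1 *: e v.
  by apply: local_mx_row; rewrite // addn1.
have r2 N' : e w *m local_mx i N' = e w.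
  by apply: local_mx_row_out; rewrite /= gtn_eqF.
have t0 N' : e u *m local_mx j N' = e u.
  by apply: local_mx_row_out; rewrite /= ltn_eqF // ej.
have t1 N' : e v *m local_mx j N' = N' 0 0 *: e v + N' 0 1 *: e w.
  by apply: local_mx_row; rewrite /= ?addn0 ?ej.
have t2 N' : e w *m local_mx j N' = N' 1 0 *: e v + N' 1 1 *: e w.
  by apply: local_mx_row; rewrite /= ?addn1 ?ej.
have uv : (u == v) = false by rewrite -val_eqE /= ltn_eqF.
have uw : (u == w) = false by rewrite -val_eqE /= ltn_eqF.
have vw : (v == w) = false by rewrite -val_eqE /= ltn_eqF.
move=> E.
have Eu := congr1 (mulmx (e u)) E; have Ev := congr1 (mulmx (e v)) E.
rewrite !mulmxA in Eu Ev.
(* One round for each of the three factors of a side. *)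
do 3 rewrite ?(r0, r1, r2, t0, t1, t2, mulmxDl, scalerDr) -?scalemxAl in Eu Ev.
rewrite !antidiag_mxE /= in Eu Ev.
have Euu := congr1 (fun A : 'rV_n => A 0 u) Eu.
have Evu := congr1 (fun A : 'rV_n => A 0 u) Ev.
have Evv := congr1 (fun A : 'rV_n => A 0 v) Ev.
have Evw := congr1 (fun A : 'rV_n => A 0 w) Ev.
move: Euu Evu Evv Evw.
rewrite !mxE ?eqxx ?[v == u]eq_sym ?[w == u]eq_sym ?[w == v]eq_sym.
rewrite ?uv ?uw ?vw /=.
rewrite !(mulr0, mul0r, addr0, add0r, mulr1, mulrA).
by move=> <- -> ->; rewrite ![f * _]mulrC => <-.
Qed.

End LocalRows.

Lemma antidiag_mx_intro (R : comUnitRingType) (N : 'M[R]_2) (g : R) :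
  g \is a GRing.unit -> N 0 0 = 0 -> N 1 1 = 0 -> N 0 1 = g -> g * N 1 0 = 1 ->
  N = antidiag_mx g.
Proof.
move=> gU N00 N11 N01 gN; have N10 : N 1 0 = g^-1.
  by apply: (mulrI gU); rewrite gN divrr.
have ord2 (k : 'I_2) : k = 0 \/ k = 1.
  by case: k => [[|[|//]] h]; [left | right]; apply/eqP.
apply/matrixP=> k l; rewrite antidiag_mxE.
by case: (ord2 k) => ->; case: (ord2 l) => ->.
Qed.

(** * Relations of the virtual twin group *)

Lemma vtwin_rho_mul (n : nat) (i : 'I_n.-1) : (vtwin_rho i * vtwin_rho i = 1)%g.
Proof.
apply: (etrans (pres_mulE _ _ _)).
exact/pres_piP/pres_rel/vtwin_rho_sq.
Qed.

Lemma vtwin_mixed_mul (n : nat) (i j : 'I_n.-1) : j = i.+1 :> nat ->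
  (vtwin_rho i * vtwin_rho j * vtwin_s i =
   vtwin_s j * vtwin_rho i * vtwin_rho j)%g.
Proof.
move=> ij; pose q u : vtwin n := \pi_(presented (@vtwin_rels n)) u.
have mulE u v : (q u * q v)%g = q (u ++ v) := pres_mulE _ u v.
have rhoE k : vtwin_rho k = q [:: (inr k, false)] by [].
have sE k : vtwin_s k = q [:: (inl k, false)] by [].
rewrite !rhoE !sE !mulE.
exact/pres_piP/pres_rel/vtwin_mixed.
Qed.

(** * The common unit *)

Theorem theorem18 (n : nat) (hn : (3 <= n)%N)
  (f : laurent int) (hf : f \is a GRing.unit)
  (eta2 : {group_hom twin n -> GL (laurent int) n})
  (heta2 : forall i : 'I_n.-1,
    eta2 (twin_s i) = local_mx i (antidiag_mx f) :> 'M[laurent int]_n)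
  (heta : {group_hom vtwin n -> GL (laurent int) n})
  (hloc : two_local heta)
  (hext : forall i : 'I_n.-1, heta (vtwin_s i) = eta2 (twin_s i)) :
  exists2 g : laurent int, g \is a GRing.unit &
    forall i : 'I_n.-1,
      heta (vtwin_s i) = local_mx i (antidiag_mx f) :> 'M[laurent int]_n /\
      heta (vtwin_rho i) = local_mx i (antidiag_mx g) :> 'M[laurent int]_n.
Proof.
have sE i : heta (vtwin_s i) = local_mx i (antidiag_mx f) :> 'M_n.
  by rewrite hext heta2.
have /fin_all_exists[N rhoE] i :
    exists N : 'M_2, heta (vtwin_rho i) = local_mx i N :> 'M_n.
  by have [_ [N [_ ->]]] := hloc i; exists (GL_mx N).
have N_invol i : local_mx i (N i) *m local_mx i (N i) = 1%:M.
  rewrite -rhoE.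
  have := congr1 (fun x => GL_mx (heta x)) (vtwin_rho_mul i).
  by rewrite gmulfM gmulf1.
have N_adj (i j : 'I_n.-1) : j = i.+1 :> nat ->
    [/\ N i 0 1 \is a GRing.unit, N i = antidiag_mx (N i 0 1)
      & N j = antidiag_mx (N i 0 1)].
  move=> ij; have := congr1 (fun x => GL_mx (heta x)) (vtwin_mixed_mul ij).
  rewrite !gmulfM /= !rhoE !sE => /(local_mx_mixed ij)[e1 e2 e3 e4].
  have [i1 i2] := local_mx_involution (N_invol i).
  have [j1 _] := local_mx_involution (N_invol j).
  have [[Ni0 Ni1 bc] [Nj0 Nj1 Njb Njc]] :=
    mixed_involutions_antidiag hf i1 i2 j1 e1 e2 (esym e3) (esym e4).
  have bU : N i 0 1 \is a GRing.unit by apply/unitrPr; exists (N i 1 0).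
  by split=> //; apply: antidiag_mx_intro => //; rewrite Njc.
have i0lt : (0 < n.-1)%N by rewrite -subn1 ltn_subRL (leq_trans _ hn).
have i1lt : (1 < n.-1)%N by rewrite -subn1 ltn_subRL (leq_trans _ hn).
pose i0 := Ordinal i0lt; pose i1 := Ordinal i1lt; pose g := N i0 0 1.
have [gU N0 _] := N_adj i0 i1 erefl.
exists g => // i; split=> //; rewrite rhoE; congr local_mx.
have [k ik] : exists k, k = i :> nat by exists i.
elim: k i ik => [|k IH] i ik; first by rewrite (_ : i = i0) //; apply: val_inj.
have klt : (k < n.-1)%N by rewrite ltnW // ik.
(* N k is already the antidiagonal matrix of g, so its (0, 1) entry is g. *)
have [_ _ ->] := N_adj (Ordinal klt) i (esym ik).
by rewrite (IH (Ordinal klt)) // antidiag_mxE.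
Qed.
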